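(* Let $\Phi$ be a conjugate Scott function on $\mathbb{K}$, let $\mathcal{H}$ be a closed subset of $\mathcal{S}$, and put $\mathcal{H}'=\mathcal{H}\setminus\{\mathbb{K}\}$, a closed subset of $\mathcal{S}'=\mathcal{S}\setminus\{\mathbb{K}\}$. Let $\{\lambda_\alpha\}$ be a net of Radon measures on $\mathcal{S}'$ supported by $\mathcal{H}'$ (i.e. $\lambda_\alpha(\mathcal{S}'\setminus\mathcal{H}')=0$). Suppose that $\lambda_\alpha(\mathcal{S}^x)\le\Phi(x)$ for all $\alpha$ and all $x\in\mathbb{K}$, and that for each $x\in\mathbb{K}$ there is some $\beta$ such that $\lambda_\alpha(\mathcal{H}^x)=\Phi(x)$ for all $\alpha\succ\beta$. Then there exists a Radon measure $\lambda$ on $\mathcal{S}'$ that represents $\Phi$ over $\mathcal{H}'$, i.e. $\lambda(\mathcal{S}'\setminus\mathcal{H}')=0$ and $\Phi(x)=\lambda(\mathcal{H}^x)$ for all $x\in\mathbb{K}$.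
   Context: A dcpo is a poset in which every (nonempty) directed subset has a supremum. In a dcpo, $x\ll y$ means that every directed $E$ with $y\le\sup E$ contains some $w$ with $x\le w$. A domain is a dcpo in which, for each $x$, the set $\{z: z\ll x\}$ is a directed lower set with supremum $x$. A subset $U$ is Scott open if it is an upper set and meets every directed $E$ with $\sup E\in U$. The Lawson topology has as subbase the Scott open sets together with the complements of the principal upper sets $\{z: x\le z\}$. $\mathbb{K}$ is a domain which is also a lattice with top element $\hat1$, such that $\hat1\ll\hat1$ and $\ll$ is multiplicative: $a\ll x$, $b\ll y$ imply $a\wedge b\ll x\wedge y$. $\mathcal{S}$ is the set of nonempty Scott open subsets of $\mathbb{K}$ ordered by inclusion; it is a continuous lattice whose Lawson topology is compact Hausdorff, and $\mathcal{S}'=\mathcal{S}\setminus\{\mathbb{K}\}$ with the subspace topology is locally compact Hausdorff. For $x\in\mathbb{K}$, $\mathcal{S}^x=\{U\in\mathcal{S}: x\notin U\}$, a compact subset of $\mathcal{S}'$, and $\mathcal{H}^x=\mathcal{H}'\cap\mathcal{S}^x$. A Radon measure is a Borel measure, finite on compact sets, inner regular on open sets and outer regular on Borel sets. A conjugate Scott function is a function $\Phi:\mathbb{K}\to[0,\infty)$ with $\Phi(x)=\inf_{z\ll x}\Phi(z)$ for all $x$ (in particular it is decreasing; it need not be bounded), normalized so that $\Phi(\hat1)=0$. *)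

(* Defs.v *)
From HB Require Import structures.
From mathcomp Require Import all_boot all_order all_algebra.
From mathcomp Require Import all_classical all_reals all_analysis.

Set Implicit Arguments.
Unset Strict Implicit.
Unset Printing Implicit Defensive.

Import Order.TTheory GRing.Theory Num.Theory.
Import SetOrder.Exports.

Local Open Scope classical_set_scope.
Local Open Scope ring_scope.

(* Stated for preorders because it is also used for the index set of a net. *)
Definition directed d (T : preorderType d) (E : set T) : Prop :=
  E !=set0 /\
  forall x y, E x -> E y -> exists2 z, E z & (x <= z)%O && (y <= z)%O.

Section DomainTheory.
Context {d : Order.disp_t} {T : porderType d}.
Implicit Types (x y z s : T) (U E : set T).

Definition lower_set U : Prop := forall x y, U y -> (x <= y)%O -> U x.

Definition upper_set U : Prop := forall x y, U x -> (x <= y)%O -> U y.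

Definition way_below x y : Prop :=
  forall E s, directed E -> supremums E s -> (y <= s)%O ->
    exists2 w, E w & (x <= w)%O.

Definition scott_open U : Prop :=
  upper_set U /\
  forall E s, directed E -> supremums E s -> U s -> E `&` U !=set0.

End DomainTheory.

Definition is_dcpo d (T : porderType d) : Prop :=
  forall E : set T, directed E -> supremums E !=set0.

Definition is_domain d (T : porderType d) : Prop :=
  is_dcpo T /\
  forall x : T, [/\ directed [set z | way_below z x],
                    lower_set [set z | way_below z x] &
                    supremums [set z | way_below z x] x].

Definition way_below_multiplicative d (T : latticeType d) : Prop :=
  forall a b x y : T, way_below a x -> way_below b y ->
    way_below (Order.meet a b) (Order.meet x y).

Definition lawson_subbase d (T : porderType d) : set (set T) :=
  [set U | scott_open U] `|` [set ~` [set z | (x <= z)%O] | x in [set: T]].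
Arguments lawson_subbase {d} T _.

(* The space S of nonempty Scott open subsets of K, ordered by inclusion (the
   order of SetOrder on [set K]) and carrying the Lawson topology. *)
Definition scott_space d (K : porderType d) : Type :=
  [set U : set K | U !=set0 /\ scott_open U].

Section ScottSpace.
Context {d : Order.disp_t} {K : porderType d}.

HB.instance Definition _ := SubChoice.on (scott_space K).
HB.instance Definition _ :=
  [SubChoice_isSubPOrder of scott_space K by <: with set_display].
HB.instance Definition _ := isSubBaseTopological.Build (scott_space K)
  (lawson_subbase (scott_space K)) id.

End ScottSpace.

(* S' = S \ {K}, with the topology induced by S. *)
Definition proper_scott_space d (K : porderType d) : Type :=
  [set U : scott_space K | \val U != [set: K]].

Section ProperScottSpace.
Context {d : Order.disp_t} {K : porderType d}.

HB.instance Definition _ := SubChoice.on (proper_scott_space K).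
HB.instance Definition _ := Topological.copy (proper_scott_space K)
  (set_type [set U : scott_space K | \val U != [set: K]]).

(* H' = H \ {K}, as a subset of S'. *)
Definition proper_part (H : set (scott_space K)) : set (proper_scott_space K) :=
  [set U | H (\val U)].

(* S^x; no member of S omitting x is K, so this is a subset of S'. *)
Definition omitting (x : K) : set (proper_scott_space K) :=
  [set U | ~ (\val (\val U) : set K) x].

End ProperScottSpace.

(* A measurableType is pointed, but S' is empty when K is reduced to a point.
   Borel measures on an arbitrary space are therefore set functions subject to
   the axioms of the factory isMeasure, relative to the sigma-algebra generated
   by the open sets; their values on other sets are irrelevant. *)
Section RadonMeasure.
Context {R : realType} {T : topologicalType}.
Implicit Types mu : set T -> \bar R.
Local Open Scope ereal_scope.

Definition borel : set (set T) := <<s @open T >>.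

Definition borel_measure mu : Prop :=
  [/\ mu set0 = 0, (forall B, borel B -> 0 <= mu B) &
      forall F : (set T)^nat, (forall n, borel (F n)) -> trivIset setT F ->
        (fun n => \sum_(0 <= i < n) mu (F i)) @ \oo --> mu (\bigcup_n F n)].

Definition radon_measure mu : Prop :=
  [/\ borel_measure mu,
      (forall C, compact C -> mu C < +oo),
      (forall U, open U ->
         mu U = ereal_sup [set mu C | C in [set C | compact C /\ C `<=` U]]) &
      (forall B, borel B ->
         mu B = ereal_inf [set mu U | U in [set U | open U /\ B `<=` U]])].

End RadonMeasure.

Definition conjugate_scott_function (R : realType) d (K : tLatticeType d)
    (Phi : K -> R) : Prop :=
  [/\ (forall x, 0 <= Phi x),
      (forall x, Phi x = inf [set Phi z | z in [set z | way_below z x]]) &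
      Phi \top%O = 0].

Definition represents_over (R : realType) d (K : porderType d)
    (lambda : set (proper_scott_space K) -> \bar R) (Phi : K -> R)
    (H' : set (proper_scott_space K)) : Prop :=
  lambda (~` H') = 0%E /\
  forall x, (Phi x)%:E = lambda (H' `&` omitting x).

(* Main.v *)
(* For [z << x] the set of all [U] that do not contain the Scott open set
   [{y | z << y}] is open and lies between the compact sets [S^x] and [S^z].
   Hence the given measures are bounded near every compact set by values of
   [Phi]. Along an ultrafilter finer than the tails of the net, their values
   on compact sets converge to a content, and Caratheodory's construction turns
   this content into a Radon measure [lambda], which on open sets is at most,
   and on compact sets at least, the limit of the net. On the open complement
   of [H'] this gives [0], on the compact set [H^x] it gives
   [Phi x <= lambda (H^x)], and the intermediate open sets give
   [lambda (H^x) <= Phi z] for all [z << x], that is, [lambda (H^x) <= Phi x]. *)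
Require Import Defs.
From HB Require Import structures.
From mathcomp Require Import all_boot all_order all_algebra.
From mathcomp Require Import all_classical all_reals all_analysis.

Set Implicit Arguments.
Unset Strict Implicit.
Unset Printing Implicit Defensive.

Import Order.TTheory GRing.Theory Num.Theory.
Import numFieldNormedType.Exports.

Local Open Scope classical_set_scope.
Local Open Scope ring_scope.

(** * Ultrafilters and compact sets in Hausdorff spaces *)

Lemma ultra_fmap (X Y : Type) (f : X -> Y) (F : set_system X) :
  UltraFilter F -> UltraFilter (f @ F).
Proof.
move=> FU; split; first exact: fmap_proper_filter.
move=> G GF FG; apply/seteqP; split=> // B GB.
have [//|FnB] := in_ultra_setVsetC (f @^-1` B) FU.
have GnB : G (~` B) by apply: FG; exact: FnB.
by have [y []] := filter_ex (filterI GB GnB).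
Qed.

Section CompactSeparation.
Context {T : topologicalType}.
Implicit Types (C U V : set T).

(** If no point of [C] were a limit, each would have a neighbourhood whose complement is in [F].
    Compactness, applied to the filter of small members of [F], yields one [W] in [F] whose
    complement is a neighbourhood of [C], hence also in [F]. Unlike in the usual criterion, [C]
    itself may fail to belong to [F]. *)
Lemma ultra_set_nbhs_cvg C (F : set_system T) : UltraFilter F ->
  compact C -> F `=>` set_nbhs C -> exists2 x, C x & F --> x.
Proof.
move=> FU Cco FC; apply: contrapT => noCvg.
have /compact_near_coveringP covC := Cco.
have : \forall W \near powerset_filter_from F, C `<=` (fun x => nbhs x (~` W)).
  apply: covC => x Cx.
  have : ~ F --> x by move=> Fx; apply: noCvg; exists x.
  move=> /existsNP[N /not_implyP[xN nFN]].
  have FnN : F (~` N) by case: (in_ultra_setVsetC N FU).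
  near=> y W; have WN : W `<=` ~` N by exact: (near (small_set_sub FnN) W).
  apply: (@filterS _ _ _ N) => [z Nz /WN//|].
  exact: (near (nbhs_interior xN) y).
case=> P [PF _ [W PW]] PC.
have FnW : F (~` W) by apply: FC => x Cx; exact: (PC _ PW _ Cx).
by have [y []] := filter_ex (filterI (PF _ PW) FnW).
Unshelve. all: by end_near. Qed.

(** Without a separation, the intersections of a neighbourhood of [C] with one of [D] generate a
    proper filter. A finer ultrafilter converges both to a point of [C] and to a point of [D], and
    these coincide in a Hausdorff space. *)
Lemma compact_separation C D : hausdorff_space T -> compact C -> compact D ->
  C `&` D = set0 -> exists U V, [/\ open U, open V, C `<=` U, D `<=` V
    & U `&` V = set0].
Proof.
move=> hT Cco Dco CD0; apply: contrapT => nosep.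
pose G := filter_from (fun UV => [/\ open UV.1, open UV.2, C `<=` UV.1
  & D `<=` UV.2]) (fun UV : set T * set T => UV.1 `&` UV.2).
have GF : ProperFilter G.
  apply: filter_from_proper.
    apply: filter_from_filter; first by exists (setT, setT); split => //;
      exact: openT.
    move=> [U V] [U' V'] [/= oU oV CU DV] [/= oU' oV' CU' DV'].
    exists (U `&` U', V `&` V'); last by move=> x [[? ?] [? ?]].
    by split => /=; [exact: openI|exact: openI|move=> x Cx; split; auto|
      move=> x Dx; split; auto].
  move=> [U V] [/= oU oV CU DV]; apply/set0P/eqP => UV0.
  by apply: nosep; exists U, V.
have [F [FU GF']] := ultraFilterLemma GF.
have [|x Cx Fx] := ultra_set_nbhs_cvg FU Cco.
  move=> W /set_nbhsP[U [oU CU UW]]; apply: GF'; exists (U, setT) => /=.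
    by split => //; exact: openT.
  by move=> x [/UW].
have [|y Dy Fy] := ultra_set_nbhs_cvg FU Dco.
  move=> W /set_nbhsP[U [oU CU UW]]; apply: GF'; exists (setT, U) => /=.
    by split => //; exact: openT.
  by move=> y [_ /UW].
have xy : x = y by exact: (cvg_unique hT Fx Fy).
by have : (C `&` D) x by [split => //; rewrite xy]; rewrite CD0.
Qed.

Lemma compact_setD C U : compact C -> open U -> compact (C `\` U).
Proof. by move=> Cco oU; apply: compact_closedI => //; exact: open_closedC. Qed.

(** The parts of [C] outside [U] and outside [V] are disjoint and compact. Removing from [C] each of
    two disjoint open sets that separate them leaves the two pieces. *)
Lemma compact_subU_split C U V : hausdorff_space T -> compact C ->
  open U -> open V -> C `<=` U `|` V -> exists C1 C2,
  [/\ compact C1, compact C2, C1 `<=` U, C2 `<=` V & C = C1 `|` C2].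
Proof.
move=> hT Cco oU oV CUV.
have CD0 : (C `\` U) `&` (C `\` V) = set0.
  by rewrite -subset0 => x [[Cx nU] [_ nV]]; case: (CUV _ Cx).
have [U' [V' [oU' oV' CU' CV' UV0]]] :=
  compact_separation hT (compact_setD Cco oU) (compact_setD Cco oV) CD0.
exists (C `\` U'), (C `\` V'); split; [exact: compact_setD|
  exact: compact_setD| | |].
- by move=> x [Cx nU']; apply: contrapT => nU; exact/nU'/CU'.
- by move=> x [Cx nV']; apply: contrapT => nV; exact/nV'/CV'.
- rewrite -setDIr UV0 setD0//.
Qed.

Lemma compact_sub_bigcup C (F : (set T)^nat) : compact C ->
  (forall i, open (F i)) -> C `<=` \bigcup_i F i ->
  exists n, C `<=` \bigcup_(i < n) F i.
Proof.
move=> /compact_near_coveringP Cco oF CF.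
have : \forall n \near \oo, C `<=` \bigcup_(i < n) F i.
  apply: (Cco _ _ (fun n x => (\bigcup_(i < n) F i) x)) => x /CF[i _ Fix].
  exists (F i, [set n | (i < n)%N]); last by move=> [y n] [/= Fiy ilt]; exists i.
  split => /=; first by apply: open_nbhs_nbhs; split.
  exact: (nbhs_infty_gt i).
by case=> n _ /(_ n (leqnn n)); exists n.
Qed.

End CompactSeparation.

(** * Extension of a content on compact sets to a Radon measure *)

Section ContentExtension.
Context {R : realType} {T : topologicalType}.
Hypothesis T_hausdorff : hausdorff_space T.
Variable kappa : set T -> R.
Hypothesis kappa_subadditive : forall C D, compact C -> compact D ->
  kappa (C `|` D) <= kappa C + kappa D.
Hypothesis kappa_additive : forall C D, compact C -> compact D ->
  C `&` D = set0 -> kappa (C `|` D) = kappa C + kappa D.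
Local Open Scope ereal_scope.

Definition inner_content (U : set T) : \bar R :=
  ereal_sup [set (kappa C)%:E | C in [set C | compact C /\ C `<=` U]].

Definition outer_content (B : set T) : \bar R :=
  ereal_inf [set inner_content U | U in [set U | open U /\ B `<=` U]].

Lemma content0 : kappa set0 = 0%R.
Proof.
have := kappa_additive (@compact0 T) (@compact0 T) (setI0 _).
by rewrite setU0 -{1}[kappa _]addr0 => /addrI.
Qed.

Lemma content_le_inner C U : compact C -> C `<=` U ->
  (kappa C)%:E <= inner_content U.
Proof. by move=> Cco CU; apply: ereal_sup_ubound; exists C. Qed.

Lemma inner_content_ge0 U : 0 <= inner_content U.
Proof.
by have := content_le_inner (@compact0 T) (sub0set U); rewrite content0.
Qed.

Lemma inner_content_le U V : U `<=` V -> inner_content U <= inner_content V.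
Proof.
move=> UV; apply: ereal_sup_le => _ [C [Cco CU] <-]; exists C => //; split=> //.
exact: subset_trans UV.
Qed.

Lemma inner_content0 : inner_content set0 = 0.
Proof.
apply/eqP; rewrite eq_le inner_content_ge0 andbT; apply: ge_ereal_sup.
move=> _ [C [_ C0] <-]; move: C0; rewrite (subset0 C) => ->.
by rewrite content0.
Qed.

(** Induction on [n]: the splitting lemma cuts [C] into a compact part covered by the first [n] sets
    and a compact part of [F n], and [kappa] is subadditive. *)
Lemma content_le_sum (F : (set T)^nat) n C : (forall i, open (F i)) ->
  compact C -> C `<=` \bigcup_(i < n) F i ->
  (kappa C)%:E <= \sum_(0 <= i < n) inner_content (F i).
Proof.
move=> oF; elim: n C => [|n IHn] C Cco CF.
  rewrite big_geq//; have -> : C = set0.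
    by rewrite -subset0 => x /CF[i /=]; rewrite ltn0.
  by rewrite content0.
have CFn : C `<=` (\bigcup_(i < n) F i) `|` F n.
  move=> x /CF[i /= /[!ltnS]]; rewrite leq_eqVlt => /predU1P[->|ilt] Fx.
    by right.
  by left; exists i.
have oFn : open (\bigcup_(i < n) F i) by exact: bigcup_open.
have [C1 [C2 [C1co C2co C1F C2F ->]]] :=
  compact_subU_split T_hausdorff Cco oFn (oF n) CFn.
rewrite big_nat_recr//=; apply: (@le_trans _ _ (kappa C1 + kappa C2)%:E).
  by rewrite lee_fin kappa_subadditive.
by rewrite EFinD leeD//; [exact: IHn|exact: content_le_inner].
Qed.

Lemma inner_content_bigcup (F : (set T)^nat) : (forall i, open (F i)) ->
  inner_content (\bigcup_i F i) <= \sum_(0 <= i <oo) inner_content (F i).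
Proof.
move=> oF; apply: ge_ereal_sup => _ [C [Cco CF] <-].
have [n Cn] := compact_sub_bigcup Cco oF CF.
apply: (le_trans (content_le_sum oF Cco Cn)).
by apply: nneseries_lim_ge => i _ _; exact: inner_content_ge0.
Qed.

Lemma outer_content_open U : open U -> outer_content U = inner_content U.
Proof.
move=> oU; apply/eqP; rewrite eq_le; apply/andP; split.
  by apply: ereal_inf_lbound; exists U => //; split.
by apply: le_ereal_inf_tmp => _ [V [_ UV] <-]; exact: inner_content_le.
Qed.

Lemma outer_content_le_inner B U : open U -> B `<=` U ->
  outer_content B <= inner_content U.
Proof. by move=> oU BU; apply: ereal_inf_lbound; exists U. Qed.

Let outer_content0 : outer_content set0 = 0.
Proof. by rewrite outer_content_open ?inner_content0//; exact: open0. Qed.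

Let outer_content_ge0 B : 0 <= outer_content B.
Proof.
by apply: le_ereal_inf_tmp => _ [U _ <-]; exact: inner_content_ge0.
Qed.

Let outer_content_le : {homo outer_content : A B / A `<=` B >-> A <= B}.
Proof.
move=> A B AB; apply: ereal_inf_le_tmp => _ [U [oU BU] <-]; exists U => //.
by split => //; exact: subset_trans BU.
Qed.

Let outer_content_sigma_subadditive : sigma_subadditive outer_content.
Proof.
move=> A; have [[i ioo]|] := pselect (exists i, outer_content (A i) = +oo).
  by rewrite (eseries_pinfty _ _ ioo) ?leey// => n _;
    rewrite -ltNye (lt_le_trans _ (outer_content_ge0 _)).
rewrite -forallNE => Aoo; apply/lee_addgt0Pr => e e0.
apply: le_trans (epsilon_trick _ _ (ltW e0)); last first.
  by move=> n; exact: outer_content_ge0.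
(* Each [A n] is enclosed in an open set whose excess is at most [e / 2 ^ n.+1]; the excesses add up
   to at most [e]. *)
have [U UA] : {U : (set T)^nat & forall n, [/\ open (U n), A n `<=` U n &
    inner_content (U n) <= outer_content (A n) + (e / (2 ^ n.+1)%:R)%:E]}.
  apply: (@choice _ _ (fun n V => [/\ open V, A n `<=` V &
    inner_content V <= outer_content (A n) + (e / (2 ^ n.+1)%:R)%:E])) => n.
  have en : (0 < e / (2 ^ n.+1)%:R)%R by rewrite divr_gt0// ltr0n expn_gt0.
  have fA : outer_content (A n) \is a fin_num.
    by rewrite ge0_fin_numE ?outer_content_ge0// lt_neqAle leey andbT; exact/eqP.
  have [_ [V [oV AV] <-] /ltW Ve] := lb_ereal_inf_adherent en fA.
  by exists V.
apply: (@le_trans _ _ (\sum_(0 <= i <oo) inner_content (U i))).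
  apply: le_trans (inner_content_bigcup (fun i => let: And3 oU _ _ := UA i in oU)).
  apply: outer_content_le_inner.
    by apply: bigcup_open => i _; have [] := UA i.
  by move=> x [i _ Aix]; exists i => //; have [_ AU _] := UA i; exact: AU.
by apply: lee_nneseries => i *; [exact: inner_content_ge0|have [] := UA i].
Qed.

HB.instance Definition _ := isOuterMeasure.Build R T outer_content
  outer_content0 outer_content_ge0 outer_content_le
  outer_content_sigma_subadditive.

Lemma content_le_outer C : compact C -> (kappa C)%:E <= outer_content C.
Proof.
move=> Cco; apply: le_ereal_inf_tmp => _ [U [_ CU] <-].
exact: content_le_inner.
Qed.

(** The test set may be replaced by an open [V] around it. Choose a compact [C] in the trace of [U]
    on [V], then a compact [D] in the open set [V] minus [C], which contains [V] minus [U]. The two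
    are disjoint compact subsets of [V], so [kappa C + kappa D] is at most the inner content of [V];
    then take suprema, first over [D], then over [C]. *)
Lemma outer_content_caratheodory_open U : open U ->
  outer_content.-caratheodory U.
Proof.
move=> oU; apply: (@le_caratheodory_measurable _ _ outer_content) => X.
apply: le_ereal_inf_tmp => _ [V [oV XV] <-].
apply: (@le_trans _ _ (inner_content (V `&` U) + outer_content (V `\` U))).
  by apply: leeD; [apply: outer_content_le_inner; [exact: openI|exact: setSI]|
    apply: outer_content_le; exact: setSI].
rewrite addeC; have [->|Voo] := eqVneq (inner_content V) +oo; first exact: leey.
have VUfin : inner_content (V `&` U) < +oo.
  by apply: le_lt_trans (inner_content_le (@subIsetl _ V U)) _; rewrite ltey.
rewrite -leeBrDl ?ge0_fin_numE ?outer_content_ge0//; last first.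
  apply: (@le_lt_trans _ _ (inner_content V)); last by rewrite ltey.
  by apply: outer_content_le_inner => //; exact: subDsetl.
apply: ge_ereal_sup => _ [C [Cco CVU] <-].
rewrite leeBrDl ?ge0_fin_numE ?outer_content_ge0//; last first.
  apply: (@le_lt_trans _ _ (inner_content V)); last by rewrite ltey.
  by apply: outer_content_le_inner => //; exact: subDsetl.
rewrite -leeBrDr//.
have oVC : open (V `\` C).
  by apply: openI => //; apply: closed_openC; exact: compact_closed.
apply: (@le_trans _ _ (inner_content (V `\` C))).
  apply: outer_content_le_inner => //; apply: setDS => x /CVU[]//.
apply: ge_ereal_sup => _ [D [Dco DVC] <-].
rewrite leeBrDr// -EFinD -kappa_additive//; last first.
  by rewrite -subset0 => x [/DVC[]].
apply: content_le_inner; first exact: compactU.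
by move=> x [/DVC[]//|/CVU[]].
Qed.

Lemma outer_content_caratheodory_borel B : borel B ->
  outer_content.-caratheodory B.
Proof.
apply: smallest_sub.
  split; first exact: caratheodory_measurable_set0.
    by move=> A mA; rewrite setTD; exact: caratheodory_measurable_setC.
  by move=> F mF; exact: caratheodory_measurable_bigcup.
exact: outer_content_caratheodory_open.
Qed.

Lemma borel_measure_outer_content : borel_measure outer_content.
Proof.
split=> [//|B _|F bF tF]; first exact: outer_content_ge0.
have mF n : outer_content.-caratheodory (F n).
  exact: outer_content_caratheodory_borel.
suff -> : outer_content (\bigcup_n F n) = \sum_(0 <= i <oo) outer_content (F i).
  by apply: is_cvg_nneseries => i *; exact: outer_content_ge0.
apply/eqP; rewrite eq_le outer_content_sigma_subadditive andTb.
(* With the union itself as test set, the remainder term is the outer content of the empty set,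
   which leaves the missing inequality. *)
have := caratheodory_lime_le mF tF (\bigcup_n F n).
rewrite setICr outer_measure0 adde0; apply: le_trans.
rewrite le_eqVlt; apply/orP; left; apply/eqP; apply: eq_eseriesr => i _.
by rewrite setIC setIidl//; exact: bigcup_sup.
Qed.

(** Outer regularity is built into [outer_content]. Inner regularity on open sets follows because
    the outer content of a compact set dominates its [kappa], and the supremum of [kappa] is already
    the value on the open set. *)
Lemma radon_measure_outer_content :
  (forall C, compact C -> outer_content C < +oo) -> radon_measure outer_content.
Proof.
move=> finC; split => //; first exact: borel_measure_outer_content.
  move=> U oU; apply/eqP; rewrite eq_le; apply/andP; split.
    rewrite outer_content_open//; apply: ge_ereal_sup => _ [C [Cco CU] <-].
    apply: (le_trans (content_le_outer Cco)).
    by apply: ereal_sup_ubound; exists C.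
  by apply: ge_ereal_sup => _ [C [_ CU] <-]; exact: outer_content_le.
move=> B _; congr ereal_inf; apply/seteqP; split=> _ [U [oU BU] <-];
  by exists U => //; rewrite outer_content_open.
Qed.

End ContentExtension.

(** * Elementary properties of Borel measures *)

Section BorelMeasure.
Context {R : realType} {T : topologicalType}.
Implicit Types (mu : set T -> \bar R) (A B : set T).
Local Open Scope ereal_scope.

Lemma borel_open A : open A -> borel A.
Proof. exact: sub_sigma_algebra. Qed.

Lemma borelC A : borel A -> borel (~` A).
Proof.
by have [_ bD _] := smallest_sigma_algebra [set: T] open => /bD; rewrite setTD.
Qed.

Lemma borel_closed A : closed A -> borel A.
Proof.
by move=> cA; rewrite -(setCK A); apply: borelC; apply: borel_open;
  exact: closed_openC.
Qed.

Lemma borelU A B : borel A -> borel B -> borel (A `|` B).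
Proof.
move=> bA bB; rewrite -bigcup2E.
have [b0 _ bcup] := smallest_sigma_algebra [set: T] open.
by apply: bcup => -[//|[//|n]].
Qed.

Lemma borelI A B : borel A -> borel B -> borel (A `&` B).
Proof.
move=> bA bB; rewrite -(setCK (A `&` B)) setCI.
by apply: borelC; apply: borelU; exact: borelC.
Qed.

Lemma borel_measure_setU mu A B : borel_measure mu -> borel A -> borel B ->
  A `&` B = set0 -> mu (A `|` B) = mu A + mu B.
Proof.
move=> [mu0 _ mu_cup] bA bB AB0.
have bF n : borel (bigcup2 A B n).
  have [b0 _ _] := smallest_sigma_algebra [set: T] open.
  by case: n => [//|[//|n]].
have tF : trivIset setT (bigcup2 A B) by rewrite -trivIset_bigcup2.
have := mu_cup _ bF tF; rewrite bigcup2E => cvgU.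
apply: (cvg_unique (@ereal_hausdorff R) cvgU).
(* All terms from index 2 on are empty, so the partial sums are constant from there. *)
apply: cvg_near_cst; exists 2%N => // -[//|[//|n]] _ /=.
rewrite big_mkord 2!big_ord_recl/= big1 ?adde0//.
Qed.

Lemma borel_measure_le mu A B : borel_measure mu -> borel A -> borel B ->
  A `<=` B -> mu A <= mu B.
Proof.
move=> bmu bA bB AB; have bBA : borel (B `&` ~` A) by apply: borelI => //; exact: borelC.
have -> : B = A `|` (B `&` ~` A) by rewrite -setDE setDUK.
rewrite borel_measure_setU//; last first.
  by rewrite setICA setICr setI0.
by case: bmu => _ mu_ge0 _; rewrite leeDl// mu_ge0.
Qed.

Lemma borel_measure_setU_le mu A B : borel_measure mu -> borel A -> borel B ->
  mu (A `|` B) <= mu A + mu B.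
Proof.
move=> bmu bA bB; have bBA : borel (B `&` ~` A) by apply: borelI => //; exact: borelC.
have -> : A `|` B = A `|` (B `&` ~` A) by rewrite setUIr setUCr setIT.
rewrite borel_measure_setU//; last by rewrite setICA setICr setI0.
by apply: leeD => //; apply: borel_measure_le => //; exact: subIsetl.
Qed.

End BorelMeasure.

(** * Limits of locally bounded families of measures along an ultrafilter *)

Section VagueLimit.
Context {R : realType} {T : topologicalType} {I : Type}.
Hypothesis T_hausdorff : hausdorff_space T.
Variable F : set_system I.
Context {F_ultra : UltraFilter F}.
Variable lam : I -> set T -> \bar R.
Hypothesis lam_borel : forall i, borel_measure (lam i).
Hypothesis lam_locally_bounded : forall C, compact C -> exists U (M : R),
  [/\ open U, C `<=` U & \forall i \near F, (lam i U <= M%:E)%E].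

Let borel_compact C : @compact T C -> borel C.
Proof. by move=> Cco; apply: borel_closed; exact: compact_closed. Qed.

(** On a compact [C] the values are finite for almost all [i] and the limit exists, so the default
    values of [fine] and [lim] do not interfere there. *)
Let kappa C : R := lim (fine (lam i C) @[i --> F]).

Let lam_fin C : compact C -> \forall i \near F, lam i C \is a fin_num.
Proof.
move=> Cco; have [U [M [oU CU UM]]] := lam_locally_bounded Cco.
near=> i; have [_ lam_ge0 _] := lam_borel i.
rewrite ge0_fin_numE; last by apply: lam_ge0; exact: borel_compact.
apply: (@le_lt_trans _ _ M%:E); last exact: ltry.
apply: (@le_trans _ _ (lam i U)); last by near: i.
by apply: (borel_measure_le (lam_borel i)) => //;
  [exact: borel_compact|exact: borel_open].
Unshelve. all: by end_near. Qed.

(** For almost all [i] the value lies in a segment from 0 to [M], which is compact, and the image of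
    an ultrafilter is an ultrafilter. *)
Let kappa_cvg C : compact C -> cvg (fine (lam i C) @[i --> F]).
Proof.
move=> Cco; have [U [M [oU CU UM]]] := lam_locally_bounded Cco.
have FU := ultra_fmap (fun i => fine (lam i C)) F_ultra.
have := @segment_compact R 0 M; rewrite compact_ultra.
move=> /(_ _ FU)[|x [_ ?]]; last by apply/cvg_ex; exists x.
have finC := lam_fin Cco.
rewrite /fmap /=; near=> i; have [_ lam_ge0 _] := lam_borel i.
rewrite /= in_itv/= -!lee_fin fineK; last by near: i.
rewrite lam_ge0/=; last exact: borel_compact.
apply: (@le_trans _ _ (lam i U)); last by near: i.
by apply: (borel_measure_le (lam_borel i)) => //;
  [exact: borel_compact|exact: borel_open].
Unshelve. all: by end_near. Qed.

Let kappa_ge C (M : R) : compact C ->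
  (\forall i \near F, (M%:E <= lam i C)%E) -> M <= kappa C.
Proof.
move=> Cco MC; apply: limr_ge; first exact: kappa_cvg.
have finC := lam_fin Cco.
near=> i; rewrite -lee_fin fineK; last by near: i.
by near: i.
Unshelve. all: by end_near. Qed.

Let kappa_le C (M : R) : compact C ->
  (\forall i \near F, (lam i C <= M%:E)%E) -> kappa C <= M.
Proof.
move=> Cco MC; apply: limr_le; first exact: kappa_cvg.
have finC := lam_fin Cco.
near=> i; rewrite -lee_fin fineK; last by near: i.
by near: i.
Unshelve. all: by end_near. Qed.

Let kappa_additive C D : compact C -> compact D -> C `&` D = set0 ->
  kappa (C `|` D) = kappa C + kappa D.
Proof.
move=> Cco Dco CD0; apply: cvg_lim => //.
apply: cvg_trans (cvgD (kappa_cvg Cco) (kappa_cvg Dco)).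
have finC := lam_fin Cco; have finD := lam_fin Dco.
apply: near_eq_cvg; near=> i => /=.
rewrite borel_measure_setU//; [|exact: borel_compact..].
by rewrite fineD//; near: i.
Unshelve. all: by end_near. Qed.

Let kappa_subadditive C D : compact C -> compact D ->
  kappa (C `|` D) <= kappa C + kappa D.
Proof.
move=> Cco Dco.
have finC := lam_fin Cco; have finD := lam_fin Dco.
have finCD := lam_fin (compactU Cco Dco).
rewrite -subr_ge0.
apply: (cvgr_to_ge (cvgB (cvgD (kappa_cvg Cco) (kappa_cvg Dco))
  (kappa_cvg (compactU Cco Dco)))).
near=> i; rewrite subr_ge0 -[leRHS]/(fine (lam i C) + fine (lam i D)) -fineD; [|by near: i..].
rewrite fine_le//; [by near: i|by rewrite fin_numD; apply/andP; split; near: i|].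
by apply: borel_measure_setU_le => //; exact: borel_compact.
Unshelve. all: by end_near. Qed.

(* The content [lim_F lam] on compact sets need not be regular, so [mu C] may
   exceed [lim_F (lam C)]. *)
Lemma exists_vague_limit : exists mu : set T -> \bar R, [/\ radon_measure mu,
  (forall U (M : R), open U ->
     (\forall i \near F, (lam i U <= M%:E)%E) -> (mu U <= M%:E)%E) &
  (forall C (M : R), compact C ->
     (\forall i \near F, (M%:E <= lam i C)%E) -> (M%:E <= mu C)%E)].
Proof.
(* On an open set the outer content is the supremum of [kappa C] over compact subsets, and each
   [lam i C] is at most [lam i U]. *)
have mu_open U M : open U -> (\forall i \near F, (lam i U <= M%:E)%E) ->
    (outer_content kappa U <= M%:E)%E.
  move=> oU UM; rewrite outer_content_open//.
  apply: ge_ereal_sup => _ [C [Cco CU] <-]; rewrite lee_fin.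
  apply: kappa_le => //; apply: filterS UM => i; apply: le_trans.
  by apply: (borel_measure_le (lam_borel i)) => //;
  [exact: borel_compact|exact: borel_open].
exists (outer_content kappa); split=> // [|C M Cco MC].
  apply: radon_measure_outer_content => // C Cco.
  have [U [M [oU CU UM]]] := lam_locally_bounded Cco.
  apply: (le_lt_trans _ (ltry M)); apply: le_trans (mu_open _ _ oU UM).
  rewrite [leRHS]outer_content_open//; exact: outer_content_le_inner.
apply: le_trans (content_le_outer _ Cco); rewrite lee_fin.
exact: kappa_ge.
Qed.

End VagueLimit.

(** * The way-below relation and Scott open sets *)

Section WayBelow.
Context {d : Order.disp_t} {K : porderType d}.
Implicit Types (x y z : K) (U : set K).

Lemma way_below_le x y : way_below x y -> (x <= y)%O.
Proof.
move=> /(_ [set y] y) [| | |_ -> //]; last by [].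
- by split; [exists y|move=> _ _ -> ->; exists y; rewrite ?lexx].
- by rewrite supremums1.
Qed.

Lemma way_below_le_trans x' x y y' : (x' <= x)%O -> way_below x y ->
  (y <= y')%O -> way_below x' y'.
Proof.
move=> x'x xy yy' E s dE sE y's.
have [w Ew xw] := xy E s dE sE (le_trans yy' y's).
by exists w => //; exact: le_trans xw.
Qed.

(* The set [D] below has the same supremum as [E]: this is the interpolation
   property of a domain. *)
Lemma scott_open_way_above z : is_domain K ->
  scott_open [set y | way_below z y].
Proof.
move=> [_ K_approx]; split=> [x y /= zx xy|E s [[w0 Ew0] dE] [ubE lubE] /= zs].
  exact: way_below_le_trans (lexx z) zx xy.
pose D := [set u | exists2 w, E w & way_below u w].
have dD : directed D.
  split.
    by have [[[u uw] _] _ _] := K_approx w0; exists u, w0.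
  move=> u1 u2 [w1 Ew1 u1w1] [w2 Ew2 u2w2].
  have [w Ew /andP[w1w w2w]] := dE _ _ Ew1 Ew2.
  have [[_ dw] _ _] := K_approx w.
  have u1w := way_below_le_trans (lexx _) u1w1 w1w.
  have u2w := way_below_le_trans (lexx _) u2w2 w2w.
  have [u uw u12] := dw u1 u2 u1w u2w.
  by exists u => //; exists w.
have sD : supremums D s.
  split=> [u [w Ew /way_below_le uw]|b ubD]; first exact: le_trans uw (ubE _ Ew).
  apply: lubE => w Ew; have [_ _ [_ lubw]] := K_approx w.
  by apply: lubw => u uw; apply: ubD; exists w.
have [u [w Ew uw] zu] := zs D s dD sD (lexx s).
by exists w; split => //=; exact: way_below_le_trans zu uw (lexx w).
Qed.

Lemma scott_open_way_below U y : is_domain K -> scott_open U -> U y ->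
  exists2 z, way_below z y & U z.
Proof.
move=> [_ /(_ y)[dy _ sy]] [_ Uo] Uy.
by have [z [zy Uz]] := Uo _ _ dy sy Uy; exists z.
Qed.

Lemma scott_open_bigcup (I : Type) (D : set I) (F : I -> set K) :
  (forall i, D i -> scott_open (F i)) -> scott_open (\bigcup_(i in D) F i).
Proof.
move=> Fo; split=> [x y [i Di Fix] xy|E s dE sE [i Di Fis]].
  by exists i => //; have [up _] := Fo i Di; exact: up xy.
have [_ Fio] := Fo i Di; have [w [Ew Fiw]] := Fio _ _ dE sE Fis.
by exists w; split => //; exists i.
Qed.

End WayBelow.

(** * The Lawson topology on the space of nonempty Scott open sets *)

Section LawsonTopology.
Context {d : Order.disp_t} {K : porderType d}.
Implicit Types (U V W : scott_space K) (x : K).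

Lemma scott_leP U V : (U <= V)%O <-> \val U `<=` \val V.
Proof. by rewrite leEsub subsetEset. Qed.

Lemma scott_spaceP U : \val U !=set0 /\ scott_open (\val U).
Proof. by have /set_mem := valP U. Qed.

Definition to_scott_space (A : set K) (A0 : A !=set0) (Ao : scott_open A) :
    scott_space K :=
  exist (fun A => A \in [set U : set K | U !=set0 /\ scott_open U]) A
    (mem_set (conj A0 Ao)).

Lemma scott_bigcup (E : set (scott_space K)) : E !=set0 ->
  exists U : scott_space K, \val U = \bigcup_(W in E) \val W.
Proof.
move=> [W EW]; have [[x Wx] _] := scott_spaceP W.
have E0 : \bigcup_(W in E) \val W !=set0 by exists x, W.
have Eo : scott_open (\bigcup_(W in E) \val W).
  by apply: scott_open_bigcup => W' _; have [] := scott_spaceP W'.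
by exists (to_scott_space E0 Eo).
Qed.

(** The union of a nonempty family in the space is again in it, hence is an upper bound of the
    family, so a supremum has no point outside the union. This is what makes the sets [omitting x]
    closed. *)
Lemma scott_open_mem x : scott_open [set U : scott_space K | \val U x].
Proof.
split=> [U V /= Ux /scott_leP|E S dE [_ lubE] /= Sx]; first exact.
have [V VE] := scott_bigcup dE.1.
have /scott_leP SV : (S <= V)%O.
  by apply: lubE => W EW; apply/scott_leP; rewrite VE; exact: bigcup_sup.
by have := SV _ Sx; rewrite VE => -[W EW Wx]; exists W.
Qed.

Lemma lawson_subbase_open B : lawson_subbase (scott_space K) B -> open B.
Proof.
move=> sB; exists [set B]; last by rewrite bigcup_set1.
by move=> _ ->; exact: (finI_from1 id sB).
Qed.

(** A Lawson neighbourhood contains a finite intersection of subbasic sets around [V], and filters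
    are stable under finite intersections. *)
Lemma lawson_cvg (F : set_system (scott_space K)) V : Filter F ->
  (forall B, lawson_subbase (scott_space K) B -> B V -> F B) -> F --> V.
Proof.
move=> FF FB A; rewrite nbhsE => -[_ [[D sD <-] [C DC CV]] CA].
rewrite nbhs_filterE; apply: filterS CA _; apply: (@filterS _ _ _ C).
  by move=> W CW; exists C.
have /sD [N sN NC] := DC; rewrite -NC; apply: filter_bigI => B NB.
by apply: FB; [have /sN := NB; rewrite inE|move: CV; rewrite -NC; exact].
Qed.

Lemma proper_val_continuous :
  continuous (\val : proper_scott_space K -> scott_space K).
Proof. exact: initial_continuous. Qed.

Lemma proper_cvg (F : set_system (proper_scott_space K))
    (V : proper_scott_space K) : Filter F -> \val @ F --> \val V -> F --> V.
Proof.
move=> FF FV A [_ [[B Bop <-] BV BA]]; rewrite nbhs_filterE.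
by apply: filterS BA _; apply: FV; exact: open_nbhs_nbhs.
Qed.

Lemma closed_omitting x : closed (@omitting d K x).
Proof.
rewrite -openC; have /continuousP := proper_val_continuous.
move=> /(_ [set U | \val U x]) mem_open.
rewrite (_ : ~` _ = \val @^-1` [set U : scott_space K | \val U x]).
  by apply: mem_open; apply: lawson_subbase_open; left; exact: scott_open_mem.
by apply/seteqP; split=> U; [exact: contrapT|move=> /= Ux; exact].
Qed.

End LawsonTopology.

(** * Compact sets [omitting x] and their open neighbourhoods *)

Section DomainWithTop.
Context {d : Order.disp_t} {K : tLatticeType d}.
Hypothesis K_domain : is_domain K.
Hypothesis K_top : way_below (\top%O : K) \top%O.
Implicit Types (U V W : scott_space K) (x y z : K).

(** Compactness of the top element puts it above every [z] in the way-below sense; this makes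
    [way_above z] a point of the space. *)
Lemma way_above_neq0 z : [set y | way_below z y] !=set0.
Proof. by exists \top%O; exact: way_below_le_trans (lex1 z) K_top (lexx _). Qed.

Definition way_above z : scott_space K :=
  to_scott_space (way_above_neq0 z) (scott_open_way_above z K_domain).

Lemma way_above_sub U z : \val U z -> \val (way_above z) `<=` \val U.
Proof.
move=> Uz y /= /way_below_le zy; have [_ [up _]] := scott_spaceP U.
exact: up zy.
Qed.

Lemma scott_space_way_below U y : \val U y ->
  exists2 z, way_below z y & \val U z.
Proof.
by move=> Uy; have [_ Uo] := scott_spaceP U; exact: scott_open_way_below.
Qed.

(** The trace on S' of a Lawson subbasic set: the complement of the principal upper set of
    [way_above z]. *)
Definition open_omitting z : set (proper_scott_space K) :=
  [set U | ~ \val (way_above z) `<=` \val (\val U)].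

Lemma open_omitting_open z : open (open_omitting z).
Proof.
have /continuousP := @proper_val_continuous d K.
move=> /(_ (~` [set U | (way_above z <= U)%O])) val_open.
rewrite (_ : open_omitting z = \val @^-1` (~` [set U | (way_above z <= U)%O])).
  by apply: val_open; apply: lawson_subbase_open; right; exists (way_above z).
by apply/seteqP; split=> U /= nzU /scott_leP.
Qed.

Lemma open_omitting_sub z : open_omitting z `<=` omitting z.
Proof. by move=> U nzU Uz; apply: nzU; exact: way_above_sub. Qed.

Lemma omitting_sub_open z x : way_below z x -> omitting x `<=` open_omitting z.
Proof. by move=> zx U nUx zU; apply: nUx; exact: zU. Qed.

(** If [y] is in [U] but not in [V], interpolate [z] way below [y] with [z] in [U]. The complement
    of [omitting z] is then a neighbourhood of [U], and [open_omitting z] is a neighbourhood of [V]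
    disjoint from it. *)
Lemma proper_scott_hausdorff : hausdorff_space (proper_scott_space K).
Proof.
have sep (U V : proper_scott_space K) y : \val (\val U) y ->
    ~ \val (\val V) y -> ~ cluster (nbhs U) V.
  move=> /scott_space_way_below[z zy Uz] nVy /(_ (~` omitting z) (open_omitting z)).
  have oz : open (~` @omitting d K z).
    by apply: closed_openC; exact: closed_omitting.
  case=> [||W [nWz /open_omitting_sub//]].
    by apply: open_nbhs_nbhs; split => //; apply.
  apply: open_nbhs_nbhs; split; first exact: open_omitting_open.
  exact: omitting_sub_open zy _ nVy.
move=> U V UV; apply: val_inj; apply: val_inj; apply/seteqP.
split=> y; apply: contraPP => ny my; first exact: sep ny UV.
by apply: sep my ny _; move=> A B /UV h /h; rewrite setIC.
Qed.

(* The limit of an ultrafilter is its limit inferior, the union of all [W]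
   with [W <= U] for almost all [U]. *)
Lemma compact_omitting x : compact (@omitting d K x).
Proof.
rewrite compact_ultra => F FU Fx.
pose E := [set W : scott_space K | \forall U \near F, (W <= \val U)%O].
have E_above z : F [set U | \val (\val U) z] -> E (way_above z).
  by apply: filterS => U Uz; apply/scott_leP; exact: way_above_sub.
have dE : directed E.
  split.
    (* Every point of the space is a nonempty upper set and so contains the top element. *)
    exists (way_above \top%O); apply: E_above; apply: filterE => U.
    have [[y Uy] [up _]] := scott_spaceP (\val U).
    by apply: up Uy _; exact: lex1.
  move=> W1 W2 E1 E2.
  have [|W WE] := @scott_bigcup _ K [set W1; W2]; first by exists W1; left.
  exists W; last first.
    by apply/andP; split; apply/scott_leP => y Wy; rewrite WE;
      [exists W1 => //; left|exists W2 => //; right].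
  apply: filterS (filterI E1 E2) => U [/scott_leP W1U /scott_leP W2U].
  by apply/scott_leP => y; rewrite WE => -[_ [->|->]]; [exact: W1U|exact: W2U].
have [V VE] := scott_bigcup dE.1.
have nVx : ~ \val V x.
  rewrite VE => -[W EW Wx].
  by have [U [/scott_leP WU]] := filter_ex (filterI EW Fx); apply; exact: WU.
have Vproper : \val V != [set: K].
  by apply/eqP => VT; apply: nVx; rewrite VT.
have supV : supremums E V.
  split=> [W EW|W ubW]; apply/scott_leP; first by rewrite VE; exact: bigcup_sup.
  by rewrite VE => y [W' /ubW/scott_leP W'W /W'W].
exists (exist (fun U => U \in [set U : scott_space K | \val U != [set: K]]) V
  (mem_set Vproper)); split => //.
apply: proper_cvg; apply: lawson_cvg => /= B [[up Bo] BV|[W _ <-] /= nWV].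
  (* Here [B] is Scott open and contains the supremum [V] of the directed set [E], so it contains
     some [W] in [E] and with it almost every [U]. *)
  have [W [EW BW]] := Bo _ _ dE supV BV.
  by apply: filterS EW => U WU; exact: up WU.
have [y Wy nVy] : exists2 y, \val W y & ~ \val V y.
  apply: contrapT => noy; apply: nWV; apply/scott_leP => y Wy.
  by apply: contrapT => nVy; apply: noy; exists y.
(* If almost every [U] contained [z], then [way_above z] would be in [E] and [y] would lie in [V].
   As [F] is an ultrafilter, almost every [U] omits [z], hence does not lie above [W]. *)
have [z zy Wz] := scott_space_way_below Wy.
have [/E_above Ez|] := in_ultra_setVsetC [set U | \val (\val U) z] FU.
  by exfalso; apply: nVy; rewrite VE; exists (way_above z).
by apply: filterS => U nUz /= /scott_leP WU; apply: nUz; exact: WU.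
Qed.

(** Each member of [C] omits some [x], hence lies in [open_omitting z] for any [z] way below [x].
    These open sets grow as [z] decreases, and binary meets make the family directed, so one of them
    covers [C]. This provides the local bounds for the limit of the measures. *)
Lemma compact_sub_open_omitting (C : set (proper_scott_space K)) : compact C ->
  exists z, C `<=` open_omitting z.
Proof.
move=> /compact_near_coveringP Cco.
pose G := filter_from [set: K] (fun z => [set y | (y <= z)%O]).
have GF : Filter G.
  apply: filter_from_filter; first by exists \top%O.
  move=> y z _ _; exists (Order.meet y z) => // w /=.
  by rewrite lexI => /andP[].
have [z _ Cz] : \forall z \near G, C `<=` open_omitting z.
  apply: (Cco K G open_omitting) => U _.
  have [x nUx] : exists x, ~ \val (\val U) x.
    apply: contrapT => nox; have /set_mem/eqP := valP U; apply.
    by apply/seteqP; split=> // x _; apply: contrapT => nUx; apply: nox; exists x.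
  have [[[z zx] _] _ _] := K_domain.2 x.
  exists (open_omitting z, [set y | (y <= z)%O]).
    split=> /=; last by exists z.
    apply: open_nbhs_nbhs; split; first exact: open_omitting_open.
    exact: omitting_sub_open zx _ nUx.
  move=> [V y] [/= zV yz] yV; apply: zV => w /= zw; apply: yV => /=.
  exact: way_below_le_trans yz zw (lexx _).
by exists z; exact: Cz (lexx z).
Qed.

End DomainWithTop.

(** * The representing measure *)

Theorem theorem4p6 (R : realType) (d : Order.disp_t) (K : tLatticeType d)
  (K_domain : is_domain K)
  (K_top : way_below (\top%O : K) \top%O)
  (K_mult : way_below_multiplicative K)
  (Phi : K -> R) (Phi_conj : conjugate_scott_function Phi)
  (H : set (scott_space K)) (H_closed : closed H)
  (dA : Order.disp_t) (A : preorderType dA) (A_directed : directed [set: A])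
  (lam : A -> set (proper_scott_space K) -> \bar R)
  (lam_radon : forall alpha, radon_measure (lam alpha))
  (lam_supp : forall alpha, lam alpha (~` proper_part H) = 0%E)
  (lam_le : forall alpha x, (lam alpha (omitting x) <= (Phi x)%:E)%E)
  (lam_ev : forall x, exists beta, forall alpha, (beta <= alpha)%O ->
    lam alpha (proper_part H `&` omitting x) = (Phi x)%:E) :
  exists lambda : set (proper_scott_space K) -> \bar R,
    radon_measure lambda /\ represents_over lambda Phi (proper_part H).
Proof.
have [A0 dA'] := A_directed; have [Phi_ge0 Phi_inf _] := Phi_conj.
have lam_borel alpha : borel_measure (lam alpha) by have [] := lam_radon alpha.
pose tails := filter_from [set: A] (fun b => [set a | (b <= a)%O]).
have tailsF : ProperFilter tails.
  apply: filter_from_proper => [|b _]; last by exists b => /=.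
  apply: filter_from_filter => [|b c _ _]; first by have [b _] := A0; exists b.
  have [e _ /andP[be ce]] := dA' b c I I.
  by exists e => // a /= ea; split; [exact: le_trans ea|exact: le_trans ea].
have [F [FU tailsSF]] := ultraFilterLemma tailsF.
pose O := open_omitting K_domain K_top.
have lam_O alpha z : (lam alpha (O z) <= (Phi z)%:E)%E.
  apply: le_trans (lam_le alpha z); apply: (borel_measure_le (lam_borel alpha)).
  - by apply: borel_open; exact: open_omitting_open.
  - by apply: borel_closed; exact: closed_omitting.
  - exact: open_omitting_sub.
have [|lambda [lambda_radon lambda_open lambda_compact]] :=
    @exists_vague_limit R _ A (proper_scott_hausdorff K_domain K_top) F FU lam
      lam_borel.
  move=> C /(compact_sub_open_omitting K_domain K_top)[z Cz].
  exists (O z), (Phi z); split => //; first exact: open_omitting_open.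
  exact: filterE.
exists lambda; split=> //.
have [lambda_borel _ _ _] := lambda_radon.
have [_ lambda_ge0 _] := lambda_borel.
have cH : closed (proper_part H).
  by apply: (closed_comp _ H_closed) => U _; exact: proper_val_continuous.
split=> [|x].
  (* The complement of H' is open and null for every [lam alpha], so the upper bound on open sets
     applies with constant 0. *)
  apply/eqP; rewrite eq_le lambda_ge0 ?andbT; last by apply: borelC; exact: borel_closed.
  apply: lambda_open; first exact: closed_openC.
  by apply: filterE => alpha; rewrite lam_supp.
have HxC : compact (proper_part H `&` omitting x).
  by rewrite setIC; apply: compact_closedI => //; exact: compact_omitting.
have bHx : borel (proper_part H `&` @omitting d K x).
  by apply: borelI; apply: borel_closed => //; exact: closed_omitting.
apply/eqP; rewrite eq_le; apply/andP; split.
  (* The equality given by [lam_ev] holds on a tail of the net, and [F] contains all tails. *)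
  apply: lambda_compact => //; have [b lam_b] := lam_ev x; apply: tailsSF.
  by exists b => // alpha /= /lam_b ->.
have lambda_le z : way_below z x ->
    (lambda (proper_part H `&` omitting x) <= (Phi z)%:E)%E.
  move=> zx; have Oz := open_omitting_open K_domain K_top z.
  apply: (@le_trans _ _ (lambda (O z))).
    apply: (borel_measure_le lambda_borel) => //; first exact: borel_open.
    by move=> U [_]; exact: omitting_sub_open.
  by apply: lambda_open => //; exact: filterE.
(* The real [inf] agrees with the extended one because the set of values is bounded below by 0 and
   nonempty, some [z] being way below [x]. *)
rewrite Phi_inf -ereal_inf_EFin; last 2 first.
- by exists 0 => _ [z _ <-].
- by have [[[z zx] _] _ _] := K_domain.2 x; exists (Phi z), z.
by apply: le_ereal_inf_tmp => _ [_ [z zx <-] <-]; exact: lambda_le.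
Qed.
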